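(* Let the $P$-representation and the $P^-$-representation be generated by the same sequence $P=(\varphi_n)_{n=0}^\infty$. Suppose that $E_1\subset(0,1]$, $E_2\subset(0,1)\setminus IS^{P^-}$, and at least one of the sets $E_1$, $E_2$ is Lebesgue-measurable. Moreover, suppose that the set of sequences of $P$-digits corresponding to numbers in $E_1$ is equal to the set of sequences of $P^-$-digits corresponding to numbers in $E_2$. Then $\lambda(E_1)=\lambda(E_2)$.
   Context: $\mathbb{N}=\{1,2,3,\dots\}$ and $\lambda$ is Lebesgue measure. $P=(\varphi_n)_{n=0}^\infty$ is a fixed sequence with $\varphi_0\in\mathbb{N}$ a constant and $\varphi_n\colon\mathbb{N}^n\to\mathbb{N}$ a function for each $n\ge1$. $P$-representation: it is known that each $x\in(0,1]$ can be uniquely written as $$x=\sum_{n=0}^{\infty}\frac{r_0 r_1 \cdots r_n}{(p_1-1)p_1\cdots(p_n-1)p_n\, p_{n+1}},$$ with $r_0=\varphi_0$, $r_n=\varphi_n(p_1,\ldots,p_n)$, $p_n\in\mathbb{N}$ and $p_n\ge r_{n-1}+1$ for all $n\in\mathbb{N}$ (the $n=0$ term is $r_0/p_1$). The number $p_n$ is the $n$th $P$-digit of $x$. $P^-$-representation of $x\in(0,1)$: an expansion $$x=\sum_{n=0}^{\infty}\frac{(-1)^n r_0 r_1 \cdots r_n}{(q_1-1)q_1\cdots (q_n-1)q_n (q_{n+1}-1)}$$ with $r_0=\varphi_0$, $r_n=\varphi_n(q_1,\ldots,q_n)$, $q_n\in\mathbb{N}$ and $q_n\ge r_{n-1}+1$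 for all $n\in\mathbb{N}$ (the $n=0$ term is $r_0/(q_1-1)$). The number $q_n$ is the $n$th $P^-$-digit of $x$. A $P^-$-cylinder $\Delta^{P^-}_{c_1\ldots c_k}$ of rank $k\ge1$ is the set, when non-empty, of all $x\in(0,1)$ having such a representation with $q_1=c_1,\ldots,q_k=c_k$. $IS^{P^-}$ is the set of all infima and suprema of all $P^-$-cylinders. Every $x\in(0,1)\setminus IS^{P^-}$ has a unique $P^-$-representation. *)

(* Defs.v *)
From mathcomp Require Import all_boot all_order all_algebra.
From mathcomp Require Import all_classical all_reals all_analysis.

Set Implicit Arguments.
Unset Strict Implicit.
Unset Printing Implicit Defensive.

Import Order.TTheory GRing.Theory Num.Theory.
Import numFieldNormedType.Exports.

Local Open Scope classical_set_scope.
Local Open Scope ring_scope.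

(* Conventions. A generating sequence (phi_n)_n is a dependent function
   [phi : forall n, n.-tuple nat -> nat]; [phi 0] is the constant phi_0 since
   there is only one empty tuple. The positive integers are modelled by the
   nonzero elements of nat, see [positive_family]. Digit sequences are indexed
   from 0: [p n] stands for the (n+1)-st digit p_{n+1}. *)

Definition positive_family (phi : forall n, n.-tuple nat -> nat) : Prop :=
  forall (n : nat) (t : n.-tuple nat),
    (forall i, (0 < tnth t i)%N) -> (0 < phi n t)%N.

(* r_n = phi_n(p_1, ..., p_n) *)
Definition rdigit (phi : forall n, n.-tuple nat -> nat) (p : nat -> nat)
    (n : nat) : nat :=
  phi n [tuple p i | i < n].

(* p_{n+1} >= r_n + 1 for every n >= 0; this forces all the digits to be
   positive. *)
Definition admissible (phi : forall n, n.-tuple nat -> nat) (p : nat -> nat) :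
    Prop :=
  forall n, (rdigit phi p n + 1 <= p n)%N.

Definition P_term (R : realType) (phi : forall n, n.-tuple nat -> nat)
    (p : nat -> nat) (n : nat) : R :=
  (\prod_(k < n.+1) (rdigit phi p k)%:R) /
  ((\prod_(k < n) (((p k)%:R - 1) * (p k)%:R)) * (p n)%:R).

Definition Pminus_term (R : realType) (phi : forall n, n.-tuple nat -> nat)
    (q : nat -> nat) (n : nat) : R :=
  ((-1) ^+ n * \prod_(k < n.+1) (rdigit phi q k)%:R) /
  ((\prod_(k < n) (((q k)%:R - 1) * (q k)%:R)) * ((q n)%:R - 1)).

Definition P_representation (R : realType)
    (phi : forall n, n.-tuple nat -> nat) (p : nat -> nat) (x : R) : Prop :=
  admissible phi p /\ series (P_term R phi p) @ \oo --> x.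

Definition Pminus_representation (R : realType)
    (phi : forall n, n.-tuple nat -> nat) (q : nat -> nat) (x : R) : Prop :=
  admissible phi q /\ series (Pminus_term R phi q) @ \oo --> x.

Definition P_digits (R : realType) (phi : forall n, n.-tuple nat -> nat)
    (E : set R) : set (nat -> nat) :=
  [set p | exists2 x, E x & P_representation phi p x].

Definition Pminus_digits (R : realType) (phi : forall n, n.-tuple nat -> nat)
    (E : set R) : set (nat -> nat) :=
  [set q | exists2 x, E x & Pminus_representation phi q x].

(* Possibly empty, whereas a cylinder is nonempty by definition: nonemptiness
   is required wherever cylinders are quantified over, see [Pminus_IS]. *)
Definition Pminus_cylinder (R : realType)
    (phi : forall n, n.-tuple nat -> nat) (k : nat) (c : k.-tuple nat) :
    set R :=
  [set x | `]0, 1[%classic x /\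
    exists2 q, Pminus_representation phi q x & forall i : 'I_k, q i = tnth c i].

Definition Pminus_IS (R : realType) (phi : forall n, n.-tuple nat -> nat) :
    set R :=
  [set y | exists (k : nat) (c : k.-tuple nat),
    [/\ (1 <= k)%N, (Pminus_cylinder phi c : set R) !=set0 &
        y = inf (Pminus_cylinder phi c) \/
        y = sup (Pminus_cylinder phi c)]].

(* [measurable] on R denotes the Borel sets; the Lebesgue-measurable sets are
   the Caratheodory-measurable sets of the Lebesgue outer measure, i.e. the
   sigma-algebra on which [completed_lebesgue_measure] is a measure. *)
Definition lebesgue_measurable (R : realType) (A : set R) : Prop :=
  (@wlength R idfun)^*%mu.-cara.-measurable A.

(* Main.v *)
Require Import Defs.
From mathcomp Require Import all_boot all_order all_algebra.
From mathcomp Require Import all_classical all_reals all_analysis.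
From mathcomp Require Import measurable_realfun ring lra.

Set Implicit Arguments.
Unset Strict Implicit.
Unset Printing Implicit Defensive.

Import Order.TTheory GRing.Theory Num.Theory.
Import numFieldNormedType.Exports.

Local Open Scope classical_set_scope.
Local Open Scope ring_scope.

(** Why the theorem holds. Reading off one digit [m] of a point [y] of the unit
    interval, when the current numerator is [r], means locating [y] between
    [r / m] and [r / (m - 1)] and rescaling that interval to the unit interval,
    preserving the orientation for the P-representation and reversing it for
    the P^- -representation ([digit_map]). Iterating, the points whose first [k]
    digits are prescribed fill, up to a countable set, the cylinder [cyl], the
    image of the unit interval under an affine map whose slope is, up to its
    sign, a product [cyl_length] of factors [r / ((m - 1) m)]. The slope does
    not feel the orientation: in both representations the cylinder of a given
    word has the same measure ([mu_cyl]).

    In either representation, cylinders are nested or disjoint and their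
    lengths tend to zero, and a digit sequence represents [x] exactly when [x]
    lies in all of its cylinders ([cvg_cyl], [cyl_cvg]). Now let [A] and [B] be
    arbitrary sets such that every point of [B] has, in one representation,
    digits that some point of [A] has in the other. Cover [A] by an open set
    [U] whose measure is close to the outer measure of [A]. The maximal
    cylinders inside [U] are disjoint, so their lengths add up to at most the
    measure of [U], and they cover the points of [A] that have digits. The
    cylinders of the other representation with the same words cover [B] and
    have the same lengths. Hence the outer measure of [B] is at most that of
    [A] ([outer_measure_le]).

    The correspondence of points with the same digits therefore preserves the
    outer measure of all sets, measurable or not. It is defined almost
    everywhere, because the digit algorithm can only fail at the countably many
    values of partial sums ([countable_nonrepresentable]). Exchanging the roles
    of the two sets gives the equality of the outer measures; applying the
    inequality to the two parts of a Caratheodory splitting transports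
    measurability ([lebesgue_measurable_digit_seqs]).

    A boolean [neg] tells the two representations apart throughout: [false]
    stands for P and [true] for P^-. *)

(** * Cylinders as affine images of the unit interval *)

Section digits.
Context (R : realType) (phi : forall n, n.-tuple nat -> nat).
Implicit Types (neg : bool) (p q : nat -> nat) (k n : nat) (x y : R).

Definition digit_term neg p : R^nat :=
  if neg then Pminus_term R phi p else P_term R phi p.

Definition cyl_length p k : R :=
  \prod_(j < k) ((rdigit phi p j)%:R / (((p j)%:R - 1) * (p j)%:R)).

(** The affine map sending the rescaled tail of an expansion, a point of the unit
    interval, to the number whose first [k] digits are those of [p]. *)
Definition cyl_map neg p k y : R :=
  series (digit_term neg p) k + ((-1) ^+ neg) ^+ k * cyl_length p k * y.

(** [cyl_map] for a single digit [m] with numerator [r]: the step from the tail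
    after that digit to the tail before it. *)
Definition digit_map neg (r m : R) y : R :=
  r / (m - neg%:R) + (-1) ^+ neg * (r / ((m - 1) * m)) * y.

(** The possible values of a tail: [`]0, 1]] for P and [`]0, 1[] for P^-. The
    value [1] is taken by the P-tails all of whose digits are minimal; a
    P^- -tail stays away from [1] because the tail that follows it is
    positive. *)
Definition unit_itv neg : set R := [set` Interval (BRight 0) (BSide neg 1)].

Definition cyl neg p k : set R := cyl_map neg p k @` unit_itv neg.

Lemma digit_termE neg p n : digit_term neg p n =
  ((-1) ^+ neg) ^+ n * cyl_length p n *
  ((rdigit phi p n)%:R / ((p n)%:R - neg%:R)).
Proof.
rewrite /digit_term /cyl_length prodf_div; case: neg.
  rewrite /Pminus_term big_ord_recr /= expr1 invfM; ring.
rewrite /P_term big_ord_recr /= expr0 expr1n subr0 invfM; ring.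
Qed.

Lemma cyl_mapS neg p k y : cyl_map neg p k.+1 y =
  cyl_map neg p k (digit_map neg (rdigit phi p k)%:R (p k)%:R y).
Proof.
rewrite /cyl_map seriesSr digit_termE /digit_map exprS.
by rewrite /cyl_length big_ord_recr /=; ring.
Qed.

Lemma unit_itvP neg y :
  unit_itv neg y <-> 0 < y /\ (if neg then y < 1 else y <= 1).
Proof.
by case: neg; rewrite /unit_itv /= in_itv /=; split=> [/andP[]|[-> ->]].
Qed.

Lemma unit_itv_closed neg y : unit_itv neg y -> 0 <= y <= 1.
Proof. by case: neg => /unit_itvP[y0 y1]; rewrite (ltW y0) //= ltW. Qed.

(** The slope [r / ((m - 1) * m)] is the distance between [r / m] and
    [r / (m - 1)]: naming it [d] removes the divisions from the bounds below. *)
Lemma digit_mapE neg (r m : R) : 1 <= r -> r + 1 <= m ->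
  exists2 d, 0 < d & r / (m - 1) = r / m + d /\
    forall y, digit_map neg r m y =
      if neg then r / (m - 1) - d * y else r / m + d * y.
Proof.
move=> r1 rm; exists (r / ((m - 1) * m)).
  by rewrite divr_gt0 ?mulr_gt0 //; lra.
split; first by field; lra.
by move=> y; rewrite /digit_map; case: neg; rewrite ?subr0 ?expr1 ?expr0; ring.
Qed.

Lemma digit_map_itvcc neg (r m : R) y : 1 <= r -> r + 1 <= m -> 0 <= y <= 1 ->
  r / m <= digit_map neg r m y <= r / (m - 1).
Proof.
move=> r1 rm /andP[y0 y1]; have [d d0 [-> ->]] := digit_mapE neg r1 rm.
by case: neg; nra.
Qed.

(** The half-open interval obtained here serves both orientations; the
    intervals for the various [m] are disjoint, so that the digit can be read
    off the point ([digit_eq]). *)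
Lemma digit_map_itvoc neg (r m : R) y : 1 <= r -> r + 1 <= m ->
  unit_itv neg y -> r / m < digit_map neg r m y <= r / (m - 1).
Proof.
move=> r1 rm yU; have [y0 y1] := (unit_itvP _ _).1 yU.
have [d d0 [-> ->]] := digit_mapE neg r1 rm.
by case: neg yU y1 => yU y1; nra.
Qed.

Lemma digit_map_unit neg (r m : R) y : 1 <= r -> r + 1 <= m ->
  unit_itv neg y -> unit_itv neg (digit_map neg r m y).
Proof.
move=> r1 rm yU; apply/unit_itvP.
have a0 : 0 < r / m by rewrite divr_gt0//; lra.
have b1 : r / (m - 1) <= 1 by rewrite ler_pdivrMr ?mul1r; lra.
have /andP[y1 y2] := digit_map_itvoc r1 rm yU; split; first lra.
case: neg yU y1 y2 => yU y1 y2; last lra.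
have [d d0 [ab E]] := digit_mapE true r1 rm; rewrite E.
by have [y0 _] := (unit_itvP _ _).1 yU; nra.
Qed.

Lemma digit_eq (r m n : nat) y :
  (r + 1 <= m)%N -> (r + 1 <= n)%N -> (0 < r)%N ->
  r%:R / m%:R < y <= r%:R / (m%:R - 1) ->
  r%:R / n%:R < y <= r%:R / (n%:R - 1) ->
  m = n.
Proof.
wlog mn : m n / (m <= n)%N.
  by move=> H rm rn r0 ym yn; case/orP: (leq_total m n) => h;
     [exact: H | symmetry; exact: H].
move=> rm rn r0 /andP[ym _] /andP[_ yn]; apply/eqP; rewrite eqn_leq mn /=.
rewrite leqNgt; apply/negP => lt_mn.
have := lt_le_trans ym yn; rewrite ltNge => /negP; apply.
have r0R : 0 < r%:R :> R by rewrite ltr0n.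
have n1 : m%:R + 1 <= n%:R :> R by rewrite natr1 ler_nat.
have m0 : 0 < m%:R :> R by rewrite ltr0n (leq_trans _ rm) // addn1.
by rewrite ler_pM2l// lef_pV2 ?posrE; lra.
Qed.

(** * Dependence on finitely many digits *)

Definition agree k p q := forall j, (j < k)%N -> p j = q j.

Lemma agreeW k n p q : (n <= k)%N -> agree k p q -> agree n p q.
Proof. by move=> nk H j jn; apply: H; exact: leq_trans nk. Qed.

Lemma rdigit_agree k p q : agree k p q -> rdigit phi p k = rdigit phi q k.
Proof.
move=> H; rewrite /rdigit; congr phi; apply: eq_from_tnth => i.
by rewrite !tnth_mktuple H.
Qed.

Lemma cyl_length_agree k p q : agree k p q -> cyl_length p k = cyl_length q k.
Proof.
move=> H; apply: eq_bigr => i _.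
by rewrite (rdigit_agree (agreeW (ltnW (ltn_ord i)) H)) H.
Qed.

Lemma cyl_map_agree neg k p q : agree k p q ->
  cyl_map neg p k =1 cyl_map neg q k.
Proof.
move=> H y; rewrite /cyl_map (cyl_length_agree H); congr (_ + _).
rewrite /series /=; apply: eq_big_nat => i /andP[_ ik].
have Hi := agreeW (ltnW ik) H.
by rewrite !digit_termE (cyl_length_agree Hi) (rdigit_agree Hi) H.
Qed.

Lemma cyl_agree neg k p q : agree k p q -> cyl neg p k = cyl neg q k.
Proof.
by move=> H; apply: eq_imagel => y _; exact: cyl_map_agree.
Qed.

(** * Nesting, disjointness and shrinking of cylinders *)

Hypothesis hphi : positive_family phi.

Lemma rdigit_gt0 p n : (forall j, (j < n)%N -> (0 < p j)%N) ->
  (0 < rdigit phi p n)%N.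
Proof. by move=> H; apply: hphi => i; rewrite tnth_mktuple H. Qed.

Lemma admissible_rdigit p n : admissible phi p -> (0 < rdigit phi p n)%N.
Proof.
by move=> ap; apply: rdigit_gt0 => j _; rewrite (leq_trans _ (ap j))// addn1.
Qed.

Lemma admissible_rdigit_ge1 p n : admissible phi p ->
  1 <= (rdigit phi p n)%:R :> R.
Proof. by move=> ap; rewrite ler1n admissible_rdigit. Qed.

Lemma admissible_digit_ge p n : admissible phi p ->
  (rdigit phi p n)%:R + 1 <= (p n)%:R :> R.
Proof. by move=> ap; rewrite natr1 ler_nat -addn1 ap. Qed.

Lemma admissible_ratio p n : admissible phi p ->
  0 < (rdigit phi p n)%:R / (p n)%:R :> R /\
  (rdigit phi p n)%:R / ((p n)%:R - 1) <= 1 :> R.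
Proof.
move=> ap; have r1 := admissible_rdigit_ge1 n ap.
have mr := admissible_digit_ge n ap.
by split; [rewrite divr_gt0; lra | rewrite ler_pdivrMr; lra].
Qed.

Lemma cyl_length_gt0 p k : admissible phi p -> 0 < cyl_length p k.
Proof.
move=> ap; apply: prodr_gt0 => i _.
have r1 := admissible_rdigit_ge1 i ap; have mr := admissible_digit_ge i ap.
by rewrite divr_gt0 ?mulr_gt0 //; lra.
Qed.

(** Each factor is at most one half: from [r <= m - 1] it is at most [1 / m], and
    [m >= 2]. *)
Lemma cyl_length_le p k : admissible phi p -> cyl_length p k <= 2^-1 ^+ k.
Proof.
move=> ap; rewrite -[k in leRHS]card_ord -prodr_const; apply: ler_prod => i _.
have r1 := admissible_rdigit_ge1 i ap; have mr := admissible_digit_ge i ap.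
apply/andP; split; first by rewrite divr_ge0 ?mulr_ge0 //; lra.
by rewrite ler_pdivrMr ?mulr_gt0; nra.
Qed.

Lemma cyl_length_cvg p : admissible phi p -> cyl_length p @ \oo --> 0.
Proof.
move=> ap; apply: (@squeeze_cvgr _ _ _ _ (fun=> 0) (fun k => 2^-1 ^+ k)).
- by near=> k; rewrite (ltW (cyl_length_gt0 k ap)) cyl_length_le.
- exact: cvg_cst.
- by apply: cvg_expr; rewrite ger0_norm; lra.
Unshelve. all: by end_near. Qed.

Lemma sgn_neq0 neg k : ((-1) ^+ neg) ^+ k != 0 :> R.
Proof. by rewrite -exprM signr_eq0. Qed.

Lemma norm_sgn neg k : `|((-1) ^+ neg) ^+ k| = 1 :> R.
Proof. by rewrite -exprM normr_sign. Qed.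

Lemma cyl_map_inj neg p k : admissible phi p -> injective (cyl_map neg p k).
Proof.
move=> ap y z /addrI /mulfI; apply.
by rewrite mulf_neq0 ?sgn_neq0 ?gt_eqF ?cyl_length_gt0.
Qed.

Lemma cyl_nested neg p k n : admissible phi p -> (k <= n)%N ->
  cyl neg p n `<=` cyl neg p k.
Proof.
move=> ap; elim: n => [|n IH]; first by rewrite leqn0 => /eqP ->.
rewrite leq_eqVlt => /predU1P[->//|kn]; apply: subset_trans (IH kn).
move=> _ [y yU <-]; rewrite cyl_mapS; apply: imageP.
by apply: digit_map_unit; rewrite // ?admissible_rdigit_ge1
  ?admissible_digit_ge.
Qed.

(** Cylinders of the same rank of different words are disjoint: the common point
    determines the digits one after the other. *)
Lemma cyl_meet_agree neg p q k x : admissible phi p -> admissible phi q ->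
  cyl neg p k x -> cyl neg q k x -> agree k p q.
Proof.
move=> ap aq; elim: k => [//|k IH] xp xq.
have apq := IH (cyl_nested ap (leqnSn k) xp) (cyl_nested aq (leqnSn k) xq).
move=> j; rewrite ltnS leq_eqVlt => /predU1P[->|/apq//].
case: xp => y yU xy; case: xq => z zU; rewrite -xy !cyl_mapS.
rewrite (cyl_map_agree _ apq) => /(cyl_map_inj aq).
have := admissible_rdigit_ge1 k ap; have := admissible_digit_ge k ap.
have := admissible_rdigit_ge1 k aq; have := admissible_digit_ge k aq.
rewrite (rdigit_agree apq) => h1 h2 h3 h4 E.
apply: (@digit_eq (rdigit phi q k) _ _
  (digit_map neg (rdigit phi q k)%:R (q k)%:R z)).
- by rewrite -(rdigit_agree apq); exact: ap.
- exact: aq.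
- exact: admissible_rdigit.
- by rewrite E; exact: digit_map_itvoc.
- exact: digit_map_itvoc.
Qed.

Lemma cyl_map_dist neg p k y z : admissible phi p ->
  0 <= y <= 1 -> 0 <= z <= 1 ->
  `|cyl_map neg p k y - cyl_map neg p k z| <= cyl_length p k.
Proof.
move=> ap /andP[y0 y1] /andP[z0 z1].
rewrite /cyl_map opprD addrACA subrr add0r -mulrBr !normrM norm_sgn mul1r.
rewrite (gtr0_norm (cyl_length_gt0 k ap)) ger_pMr ?cyl_length_gt0 //.
by rewrite ler_norml; lra.
Qed.

(** * Representing a number means lying in all the cylinders *)

(** Unfolding the digits [p k, ..., p (k + n - 1)] from the inside out only
    composes maps that preserve the closed unit interval. *)
Lemma series_cyl_map neg p k n : admissible phi p ->
  exists2 y : R, 0 <= y <= 1 &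
    series (digit_term neg p) (k + n)%N = cyl_map neg p k y.
Proof.
move=> ap; elim: n k => [|n IH] k.
  by exists 0; rewrite ?addn0 /cyl_map ?mulr0 ?addr0; lra.
have [y y01 E] := IH k.+1; rewrite addnS -addSn E cyl_mapS; eexists; last by [].
have [a0 b1] := admissible_ratio k ap.
have := digit_map_itvcc neg (admissible_rdigit_ge1 k ap)
  (admissible_digit_ge k ap) y01.
by lra.
Qed.

(** Passing to the limit in the previous lemma gives only a coordinate in the
    closed unit interval. The endpoints are excluded by looking further: every
    coordinate is at least some [r / m > 0]; and when the orientation is
    reversed, a coordinate equals [r / (m - 1)] minus a positive multiple of the
    next one, hence it is less than [1]. *)
Lemma cvg_cyl neg p x : admissible phi p ->
  series (digit_term neg p) @ \oo --> x -> forall k, cyl neg p k x.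
Proof.
move=> ap sx.
have cc k : exists2 y, 0 <= y <= 1 & x = cyl_map neg p k y.
  pose c := ((-1) ^+ neg) ^+ k * cyl_length p k.
  have c0 : c != 0 by rewrite mulf_neq0 ?sgn_neq0 ?gt_eqF ?cyl_length_gt0.
  (* the inverse of the affine map [cyl_map neg p k] *)
  pose g t := (t - series (digit_term neg p) k) / c.
  have gx : (fun n => g (series (digit_term neg p) n)) @ \oo --> g x.
    by apply: cvgMl; apply: cvgB => //; exact: cvg_cst.
  have gn : \forall n \near \oo, 0 <= g (series (digit_term neg p) n) <= 1.
    near=> n; have [y y01] := @series_cyl_map neg p k (n - k) ap.
    rewrite subnKC; last by near: n; exact: nbhs_infty_ge.
    by move=> ->; rewrite /g /cyl_map addrC addKr -/c mulrC mulKf.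
  exists (g x); last by rewrite /cyl_map -/c /g mulrC divfK // addrC subrK.
  apply/andP; split.
    by apply: (cvgr_to_ge gx); apply: filterS gn => n /andP[].
  by apply: (cvgr_to_le gx); apply: filterS gn => n /andP[].
move=> k; have [a0 b1] := admissible_ratio k ap.
have [a0' b1'] := admissible_ratio k.+1 ap.
have [z z01] := cc k.+2; rewrite 2!cyl_mapS.
have := digit_map_itvcc neg (admissible_rdigit_ge1 k.+1 ap)
  (admissible_digit_ge k.+1 ap) z01.
set y := digit_map _ _ _ z => yab xz.
exists (digit_map neg (rdigit phi p k)%:R (p k)%:R y) => //.
have y01 : 0 < y <= 1 by lra.
apply/unit_itvP.
have [d d0 [ab ->]] := digit_mapE neg (admissible_rdigit_ge1 k ap)
  (admissible_digit_ge k ap).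
by case: (neg); nra.
Unshelve. all: by end_near. Qed.

Lemma cyl_cvg neg p x : admissible phi p -> (forall k, cyl neg p k x) ->
  series (digit_term neg p) @ \oo --> x.
Proof.
move=> ap xc; apply/cvgrPdist_lt => e e0.
have /cvgrPdist_lt/(_ _ e0) := cyl_length_cvg ap; apply: filterS => k.
rewrite sub0r normrN (gtr0_norm (cyl_length_gt0 k ap)); apply: le_lt_trans.
have [y yU <-] := xc k.
rewrite [X in _ - X](_ : _ = cyl_map neg p k 0); last first.
  by rewrite /cyl_map mulr0 addr0.
by apply: cyl_map_dist => //; [exact: unit_itv_closed yU|rewrite lexx ler01].
Qed.

(** The terms are dominated by those of a geometric series, because
    [r <= m - 1]. *)
Lemma admissible_cvg neg p : admissible phi p ->
  exists x, forall k, cyl neg p k x.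
Proof.
move=> ap; suff /cvg_ex[x sx] : cvgn (series (digit_term neg p)).
  by exists x; exact: cvg_cyl.
apply: normed_cvg; apply: (@series_le_cvg _ _ (geometric 1 2^-1)).
- by move=> n; exact: normr_ge0.
- by move=> n; rewrite /= mul1r exprn_ge0 //; lra.
- move=> n; rewrite /= mul1r digit_termE -mulrA normrM norm_sgn mul1r normrM.
  rewrite (gtr0_norm (cyl_length_gt0 n ap)).
  have r1 := admissible_rdigit_ge1 n ap; have mr := admissible_digit_ge n ap.
  rewrite (le_trans _ (cyl_length_le n ap)) // ger_pMr ?cyl_length_gt0 //.
  have m0 : 0 < (p n)%:R - neg%:R :> R by case: (neg) => /=; lra.
  rewrite ger0_norm; last by rewrite divr_ge0 // ltW.
  by rewrite ler_pdivrMr // mul1r; case: (neg) => /=; lra.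
- by apply: is_cvg_geometric_series; rewrite ger0_norm; lra.
Qed.

(** * Almost every number has digits *)

(** The digit is [m = floor (r / y) + 1]. With the reversed orientation the new
    tail vanishes when [y] is exactly [r / (m - 1)]. *)
Lemma digit_exists neg (r : nat) y : (0 < r)%N -> unit_itv neg y ->
  exists2 m : nat, (r + 1 <= m)%N &
    exists2 z, z = 0 \/ unit_itv neg z & y = digit_map neg r%:R m%:R z.
Proof.
move=> r0 /unit_itvP[y0 y1]; have {}y1 : y <= 1 by case: neg y1 => // /ltW.
have r0R : 1 <= r%:R :> R by rewrite ler1n.
have /andP[] := truncn_itv (divr_ge0 (ltW (lt_le_trans ltr01 r0R)) (ltW y0)).
set t := Num.truncn _; rewrite ler_pdivlMr // ltr_pdivrMr // -natr1 => h1 h2.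
have rt : (r <= t)%N by rewrite -ltnS -(ltr_nat R) -natr1; nra.
exists t.+1; first by rewrite addn1 ltnS.
have rm1 : r%:R + 1 <= t.+1%:R :> R by rewrite -natr1 lerD2r ler_nat.
have [d d0 [ab E]] := digit_mapE neg r0R rm1.
have lo : r%:R / t.+1%:R < y by rewrite ltr_pdivrMr -?natr1; lra.
have hi : y <= r%:R / (t.+1%:R - 1) by rewrite ler_pdivlMr -?natr1 ?addrK; lra.
move: (r%:R / t.+1%:R) (r%:R / (t.+1%:R - 1)) lo hi ab E => a b lo hi ab E.
exists (if neg then (b - y) / d else (y - a) / d); last first.
  by rewrite E; case: (neg); rewrite [d * _]mulrC divfK ?gt_eqF //; ring.
case: neg E => E.
  have z1 : (b - y) / d < 1 by rewrite ltr_pdivrMr //; lra.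
  move: hi; rewrite le_eqVlt => /predU1P[<-|hi].
    by left; rewrite subrr mul0r.
  by right; apply/unit_itvP; rewrite divr_gt0 // subr_gt0.
right; apply/unit_itvP; rewrite divr_gt0 ?subr_gt0 //; split=> //.
by rewrite ler_pdivrMr //; lra.
Qed.

Lemma agree_mkseq p k : agree k (nth 0%N (mkseq p k)) p.
Proof. by move=> j jk; rewrite nth_mkseq. Qed.

(** When [x] is no partial sum, no tail vanishes and the digit algorithm never
    stops. Since the numerator [r] depends on all the previous digits, the
    construction carries a whole sequence [p] of which only the first [k] terms
    matter, and modifies its [k]-th term at step [k]. *)
Lemma digits_exist neg x : unit_itv neg x ->
  (forall p k, x <> series (digit_term neg p) k) ->
  exists2 p, admissible phi p & forall k, cyl neg p k x.
Proof.
move=> xU xs.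
pose upd p k m : nat -> nat := fun j => if j == k then m else p j.
pose inv k p := (forall j, (j < k)%N -> (rdigit phi p j + 1 <= p j)%N) /\
  cyl neg p k x.
have agree_upd p k m : agree k (upd p k m) p.
  by move=> j jk; rewrite /upd ltn_eqF.
have /choice[f hf] : forall u : nat * (nat -> nat), exists m,
    inv u.1 u.2 -> inv u.1.+1 (upd u.2 u.1 m).
  move=> [k p] /=; have [[adm [y yU xy]]|] := pselect (inv k p);
    last by exists 0%N.
  have r0 : (0 < rdigit phi p k)%N.
    by apply: rdigit_gt0 => j /adm; apply: leq_trans; rewrite addn1.
  have [m rm1 [z z0U yz]] := digit_exists r0 yU.
  exists m => _; have kk : upd p k m k = m by rewrite /upd eqxx.
  have xz : x = cyl_map neg (upd p k m) k.+1 z.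
    rewrite cyl_mapS kk (rdigit_agree (agree_upd p k m)) -yz -xy.
    by rewrite (cyl_map_agree _ (agree_upd p k m)).
  split; last first.
    case: z0U => [z0|zU]; last by exists z.
    by case: (xs (upd p k m) k.+1); rewrite xz z0 /cyl_map mulr0 addr0.
  move=> j; rewrite ltnS leq_eqVlt => /predU1P[->|jk].
    by rewrite kk (rdigit_agree (agree_upd p k m)).
  by rewrite (rdigit_agree (agreeW (ltnW jk) (agree_upd p k m))) agree_upd ?adm.
pose P := fix P k :=
  if k is k'.+1 then upd (P k') k' (f (k', P k')) else fun=> 0%N.
have invP k : inv k (P k).
  elim: k => [|k IH]; last exact: (hf (k, P k)).
  split=> //; exists x => //.
  rewrite /cyl_map /series /= /cyl_length big_ord0 big_geq //.
  by rewrite expr0 !mul1r add0r.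
have PS k n : agree k (P (k + n)%N) (P k).
  elim: n => [|n IH]; first by rewrite addn0.
  rewrite addnS => j jk; rewrite /= (agree_upd _ _ _ _ _) ?IH //.
  by rewrite (leq_trans jk) // leq_addr.
pose p k := P k.+1 k.
have Pp k : agree k (P k) p.
  by move=> j jk; rewrite /p -(subnKC jk) PS.
exists p => [k|k]; last by rewrite -(cyl_agree neg (Pp k)); exact: (invP k).2.
have := (invP k.+1).1 k (ltnSn k).
by rewrite (rdigit_agree (agreeW (leqnSn k) (Pp k.+1))).
Qed.

Definition representable neg : set R :=
  [set x | exists2 p, admissible phi p & forall k, cyl neg p k x].

(** A partial sum depends on finitely many digits only, so there are no more
    partial sums than finite words. *)
Lemma countable_nonrepresentable neg :
  countable (unit_itv neg `\` representable neg).
Proof.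
apply: (@sub_countable _ _ _ (range (fun w : seq nat =>
  series (digit_term neg (nth 0%N w)) (size w)))); last first.
  by apply: sub_countable (card_image_le _ _) _; exact: countableP.
apply: subset_card_le => x [xU xN]; apply: contrapT => xs; apply: xN.
apply: digits_exist => // p k xpk; apply: xs; exists (mkseq p k) => //.
have := cyl_map_agree neg (@agree_mkseq p k) 0.
by rewrite /cyl_map !mulr0 !addr0 size_mkseq -xpk.
Qed.

(** * The measure of cylinders *)

Let mu := @lebesgue_measure R.

Lemma affine_unit_itv neg (s c : R) : c != 0 ->
  exists2 i : interval R, (fun y => s + c * y) @` unit_itv neg = [set` i] &
    mu [set` i] = `|c|%:E.
Proof.
rewrite neq_lt => /orP[c0|c0].
  exists (Interval (BSide (~~ neg) (s + c)) (BLeft s)); last first.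
    rewrite /mu lebesgue_measure_itv /= lte_fin gtrDl c0 ltr0_norm//.
    by rewrite -EFinD opprD addNKr.
  apply/seteqP; split=> [_ [y /unit_itvP[y0 y1] <-]|x].
    by case: neg y1 => y1; rewrite /= in_itv /=; apply/andP; split; nra.
  move=> xi; exists ((x - s) / c); last by rewrite mulrC divfK ?subrKC ?lt_eqF.
  move: xi; rewrite /= in_itv /= => /andP[x1 x2]; apply/unit_itvP.
  split; first by rewrite ltr_ndivlMr // mul0r subr_lt0.
  by case: neg x1 => /= x1; rewrite ?ltr_ndivrMr ?ler_ndivrMr // mul1r; lra.
exists (Interval (BRight s) (BSide neg (s + c))); last first.
  rewrite /mu lebesgue_measure_itv /= lte_fin ltrDl c0 gtr0_norm//.
  by rewrite -EFinD addrAC subrr add0r.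
apply/seteqP; split=> [_ [y /unit_itvP[y0 y1] <-]|x].
  by case: neg y1 => y1; rewrite /= in_itv /=; apply/andP; split; nra.
move=> xi; exists ((x - s) / c); last by rewrite mulrC divfK ?subrKC ?gt_eqF.
move: xi; rewrite /= in_itv /= => /andP[x1 x2]; apply/unit_itvP.
split; first by rewrite divr_gt0 // subr_gt0.
by case: neg x2 => /= x2; rewrite ?ltr_pdivrMr ?ler_pdivrMr // mul1r; lra.
Qed.

Lemma measurable_cyl neg p k : admissible phi p ->
  measurable (cyl neg p k : set (measurableTypeR R)).
Proof.
move=> ap; rewrite /cyl /cyl_map.
have c0 : ((-1) ^+ neg) ^+ k * cyl_length p k != 0.
  by rewrite mulf_neq0 ?sgn_neq0 ?gt_eqF ?cyl_length_gt0.
by have [i -> _] := affine_unit_itv neg (series (digit_term neg p) k) c0.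
Qed.

Lemma mu_cyl neg p k : admissible phi p ->
  mu (cyl neg p k) = (cyl_length p k)%:E.
Proof.
move=> ap; rewrite /cyl /cyl_map.
have c0 : ((-1) ^+ neg) ^+ k * cyl_length p k != 0.
  by rewrite mulf_neq0 ?sgn_neq0 ?gt_eqF ?cyl_length_gt0.
have [i -> ->] := affine_unit_itv neg (series (digit_term neg p) k) c0.
by rewrite normrM norm_sgn mul1r gtr0_norm ?cyl_length_gt0.
Qed.

Lemma cyl_in_open neg p x (U : set R) : admissible phi p ->
  (forall k, cyl neg p k x) -> open U -> U x -> exists k, cyl neg p k `<=` U.
Proof.
move=> ap xc oU Ux.
have /nbhs_ballP[e /= e0 xU] : nbhs x U by exact: open_nbhs_nbhs.
have /cvgrPdist_lt/(_ _ e0)[k _ /(_ k (leqnn k))] := cyl_length_cvg ap.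
rewrite sub0r normrN (gtr0_norm (cyl_length_gt0 k ap)) => ke.
exists k => _ [y yU <-]; apply: xU; apply: le_lt_trans ke.
have [z zU <-] := xc k.
by apply: cyl_map_dist; rewrite ?(unit_itv_closed yU) ?(unit_itv_closed zU).
Qed.

(** * Comparison of outer measures and of measurability *)

Let mustar := ((@wlength R idfun)^*)%mu.

(** No measurability is assumed, which is what allows this inequality to be used
    on the pieces of a Caratheodory splitting. *)
Lemma outer_measure_le neg neg' (A B : set R) :
  (forall b, B b -> exists p, [/\ admissible phi p, forall k, cyl neg' p k b &
    exists2 a, A a & forall k, cyl neg p k a]) ->
  (mustar B <= mustar A)%E.
Proof.
move=> AB; apply/lee_addgt0Pr => e e0.
have [U [oU AU]] := outer_measure_open_le A e0; apply: le_trans.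
(* [cyl neg p k] is a maximal cylinder inside [U] *)
pose good p k := [/\ admissible phi p, cyl neg p k `<=` U &
  forall j, (j < k)%N -> ~ cyl neg p j `<=` U].
(* words are numbered by [pickle], since measures are additive over families
   indexed by nat *)
pose D := [set i | exists p k, good p k /\ i = pickle (mkseq p k)].
pose wd i := odflt [::] (unpickle i : option (seq nat)).
pose I b i := cyl b (nth 0%N (wd i)) (size (wd i)).
have ID b p k : I b (pickle (mkseq p k)) = cyl b p k.
  by rewrite /I /wd pickleK /= size_mkseq (cyl_agree b (@agree_mkseq p k)).
have mI b i : D i -> measurable (I b i : set (measurableTypeR R)).
  by move=> [p [k [[ap _ _] ->]]]; rewrite ID; exact: measurable_cyl.
have mIE b b' i : D i -> mu (I b i) = mu (I b' i).
  by move=> [p [k [[ap _ _] ->]]]; rewrite !ID !mu_cyl.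
have tI : trivIset D (I neg).
  move=> i j [p [k [[ap pU pm] ->]]] [q [n [[aq qU qm] ->]]].
  rewrite !ID => -[x [xp xq]].
  wlog kn : p q k n ap aq pU qU pm qm xp xq / (k <= n)%N.
    move=> H; case/orP: (leq_total k n) => h; first exact: H.
    by symmetry; apply: H.
  have apq := cyl_meet_agree ap aq xp (cyl_nested aq kn xq).
  move: kn; rewrite leq_eqVlt => /predU1P[kn|kn].
    rewrite -kn; congr pickle; apply/eq_in_map => j'.
    by rewrite mem_iota /= add0n => /apq.
  by case: (qm k kn); rewrite -(cyl_agree neg apq).
have BI : B `<=` \bigcup_(i in D) I neg' i.
  move=> b /AB[p [ap bp [a /AU Ua ac]]].
  have [k0 k0U] := cyl_in_open ap ac oU Ua.
  have ex : exists k, `[< cyl neg p k `<=` U >] by exists k0; apply/asboolP.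
  case: (ex_minnP ex) => k /asboolP kU kmin.
  exists (pickle (mkseq p k)); last by rewrite ID.
  exists p, k; split=> //; split=> // j jk /asboolP /kmin.
  by rewrite leqNgt jk.
apply: (@le_trans _ _ (mu (\bigcup_(i in D) I neg i))); last first.
  apply: le_measure; rewrite ?inE.
  - by apply: bigcup_measurable => i /mI.
  - exact: open_measurable.
  - by apply: bigcup_sub => i [p [k [[_ pU _] ->]]]; rewrite ID.
apply: (@le_trans _ _ (mustar (\bigcup_(i in D) I neg' i))).
  exact: le_outer_measure.
rewrite /mu (measure_bigcup (@lebesgue_measure R)) //; last by move=> i /mI.
rewrite bigcup_mkcond eseries_mkcond.
apply: (le_trans (outer_measure_sigma_subadditive mustar _)).
apply: lee_nneseries => [i _ _|i _]; first exact: outer_measure_ge0.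
case: ifPn => iD; last by rewrite outer_measure0.
by rewrite [leRHS](mIE neg neg') //; exact: set_mem.
Qed.

(** The points of [B] without digits form a null set, so only the representable
    ones have to be matched with points of [A]. *)
Lemma outer_measure_le_ae neg neg' (A B : set R) : B `<=` unit_itv neg' ->
  (forall b p, B b -> admissible phi p -> (forall k, cyl neg' p k b) ->
    exists2 a, A a & forall k, cyl neg p k a) ->
  (mustar B <= mustar A)%E.
Proof.
move=> BU AB.
have N0 : mustar (unit_itv neg' `\` representable neg') = 0%E.
  exact/countable_lebesgue_measure0/countable_nonrepresentable.
have BV : B `<=` (B `&` representable neg') `|`
    (unit_itv neg' `\` representable neg').
  move=> b Bb; have [bV|bV] := pselect (representable neg' b); first by left.
  by right; split=> //; exact: BU.
apply: (le_trans (le_outer_measure mustar _ _ BV)).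
apply: (le_trans (outer_measureU2 mustar _ _)).
rewrite [X in (_ + X)%E]N0 adde0.
apply: (@outer_measure_le neg neg') => b [Bb [p ap bp]].
by exists p; split=> //; exact: (AB b p).
Qed.

Definition digit_seqs neg (E : set R) : set (nat -> nat) :=
  [set p | admissible phi p /\ exists2 x, E x & forall k, cyl neg p k x].

Lemma outer_measure_le_digit_seqs neg neg' (E E' : set R) :
  E' `<=` unit_itv neg' ->
  digit_seqs neg E = digit_seqs neg' E' -> (mustar E' <= mustar E)%E.
Proof.
move=> EU EE; apply: (outer_measure_le_ae (neg := neg) EU) => b p Eb ap bp.
have : digit_seqs neg' E' p by split=> //; exists b.
by rewrite -EE => -[].
Qed.

(** A test set [X] is first cut by the unit interval, which is measurable. The
    part [Y] inside corresponds to a set [C] on the other side; [E] splits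
    [C] additively, and the pieces dominate those of [Y], while [C] itself is
    dominated by [Y]. Uniqueness of the limit keeps the points of [C] that
    correspond to points outside [E'] out of [E]. *)
Lemma lebesgue_measurable_digit_seqs neg neg' (E E' : set R) :
  E' `<=` unit_itv neg' ->
  digit_seqs neg E = digit_seqs neg' E' -> lebesgue_measurable E ->
  lebesgue_measurable E'.
Proof.
move=> EU EE mE; apply: le_caratheodory_measurable => X.
have mK : mustar.-caratheodory (unit_itv neg').
  have : measurable (unit_itv neg' : set (measurableTypeR R)).
    exact: measurable_itv.
  exact: sub_caratheodory.
rewrite [leRHS](mK X).
pose Y := X `&` unit_itv neg'.
pose C := [set a | exists p, [/\ admissible phi p, forall k, cyl neg p k a &
    exists2 b, Y b & forall k, cyl neg' p k b]].
have CY : (mustar C <= mustar Y)%E.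
  exact: (@outer_measure_le neg' neg).
have XE : (mustar (X `&` E') <= mustar (C `&` E))%E.
  apply: (@outer_measure_le_ae neg neg'); first by move=> x [_ /EU].
  move=> b p [Xb Eb] ap bp.
  have : digit_seqs neg' E' p by split=> //; exists b.
  rewrite -EE => -[_ [a Ea pa]]; exists a => //; split=> //.
  by exists p; split=> //; exists b => //; split=> //; exact: EU.
have YE : (mustar (Y `&` ~` E') <= mustar (C `&` ~` E))%E.
  apply: (@outer_measure_le_ae neg neg'); first by move=> x [[]].
  move=> b p [Yb Eb] ap bp; have [a pa] := admissible_cvg neg ap.
  exists a => //; split; first by exists p; split=> //; exists b.
  move=> Ea; have : digit_seqs neg E p by split=> //; exists a.
  rewrite EE => -[_ [b' Eb' pb']]; apply: Eb.
  suff -> : b = b' by [].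
  exact: (cvg_unique _ (cyl_cvg ap bp) (cyl_cvg ap pb')).
have XN : (mustar (X `&` ~` E') <=
    mustar (Y `&` ~` E') + mustar (X `&` ~` unit_itv neg'))%E.
  apply: le_trans (outer_measureU2 mustar _ _); apply: le_outer_measure.
  by move=> x [Xx Ex]; have [xU|xU] := pselect (unit_itv neg' x); [left|right].
apply: (le_trans (leeD XE XN)); rewrite addeA leeD2r //.
apply: le_trans CY; rewrite [leRHS](mE C); exact: leeD.
Qed.

Lemma representation_cyl neg p x : admissible phi p ->
  (series (digit_term neg p) @ \oo --> x) <-> (forall k, cyl neg p k x).
Proof. by move=> ap; split; [exact: cvg_cyl|exact: cyl_cvg]. Qed.

Lemma P_digitsE (E : set R) : P_digits phi E = digit_seqs false E.
Proof.
apply/seteqP; split=> p /=.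
  by move=> [x Ex [ap /(@representation_cyl false _ _ ap) h]]; split=> //; exists x.
by move=> [ap [x Ex /(@representation_cyl false _ _ ap) h]]; exists x.
Qed.

Lemma Pminus_digitsE (E : set R) : Pminus_digits phi E = digit_seqs true E.
Proof.
apply/seteqP; split=> p /=.
  by move=> [x Ex [ap /(@representation_cyl true _ _ ap) h]]; split=> //; exists x.
by move=> [ap [x Ex /(@representation_cyl true _ _ ap) h]]; exists x.
Qed.

End digits.

Theorem corollary5p3 (R : realType) (phi : forall n, n.-tuple nat -> nat)
    (hphi : positive_family phi) (E1 E2 : set R)
    (hE1 : E1 `<=` `]0, 1]) (hE2 : E2 `<=` `]0, 1[ `\` Pminus_IS phi)
    (hmeas : lebesgue_measurable E1 \/ lebesgue_measurable E2)
    (hdigits : P_digits phi E1 = Pminus_digits phi E2) :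
  [/\ lebesgue_measurable E1, lebesgue_measurable E2 &
      completed_lebesgue_measure E1 = completed_lebesgue_measure E2].
Proof.
have hE2' : E2 `<=` unit_itv true by move=> x /hE2[].
move: hdigits; rewrite (P_digitsE hphi) (Pminus_digitsE hphi) => EE.
split.
- case: hmeas => // m2.
  exact: (lebesgue_measurable_digit_seqs hphi hE1 (esym EE)).
- case: hmeas => // m1.
  exact: (lebesgue_measurable_digit_seqs hphi hE2' EE).
- apply/eqP; rewrite eq_le; apply/andP; split.
    exact: (outer_measure_le_digit_seqs hphi hE1 (esym EE)).
  exact: (outer_measure_le_digit_seqs hphi hE2' EE).
Qed.
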